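(* Let $A\in\mathbb{N}^{n\times m}$ have nonzero columns and let $\lambda\in\mathbb{R}_{>0}^n$. Assume that $A$ is surjective and that $A\mu=\lambda$ for some $\mu\in\mathbb{R}^m$ with $\mu_k>0$ for all $k$. Let $q\mapsto s(q)$ be a deterministic, state-only tie-breaking rule (a function $s:\mathbb{Z}^n\to\mathbb{N}^m$ such that $s(q)$ is a maximizer of $\langle q,As\rangle$ over $s\in\mathbb{N}^m$, $\|s\|_1\le2$) satisfying the idle clause: $s(q)=0$ whenever $\max_k\langle q,A_k\rangle\le0$. Then the virtual chain $(Q(t))_{t\in\mathbb{N}}$ started at $Q(0)=0$ is positive recurrent on the communicating class of $0$, which coincides with the set of states reachable from $0$; in particular $m_0:=\mathbb{E}_0[\tau_0^+]<\infty$, where $\tau_0^+=\inf\{t\ge1:Q(t)=0\}$.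
   Context: $\mathbb{N}$ contains $0$. $A_k$ denotes the $k$-th column of $A$; $A$ is surjective if $A\mathbb{R}^m=\mathbb{R}^n$. Let $\bar\lambda=\lambda/\sum_i\lambda_i$. The virtual chain is the Markov chain on $\mathbb{Z}^n$ (signed, no reflection) given by $Q(t+1)=Q(t)+a(t)-A\,s(Q(t))$, where $(a(t))_{t\in\mathbb{N}}$ are i.i.d. with values in $\{e_1,\dots,e_n\}$ and $\mathbb{P}(a(t)=e_i)=\bar\lambda_i$, $a(t)$ being independent of $Q(0),\dots,Q(t)$. $\mathbb{E}_0$ is expectation for the chain started at $Q(0)=0$. *)

(* Defs.v *)
From mathcomp Require Export all_boot all_order all_algebra.
From mathcomp Require Export all_classical all_reals all_analysis.

Set Implicit Arguments.
Unset Strict Implicit.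
Unset Printing Implicit Defensive.

Import Order.TTheory GRing.Theory Num.Theory.

Local Open Scope classical_set_scope.
Local Open Scope ring_scope.

(* Matrices over [nat], the natural numbers including 0, are multiplied over
   the semiring [nat] and then cast entrywise to [int] or to the reals. *)
Definition natmx (K : pzSemiRingType) (p r : nat) (M : 'M[nat]_(p, r)) :
  'M[K]_(p, r) := map_mx (fun k : nat => k%:R) M.

Definition surjective_mx (R : realType) (n m : nat) (A : 'M[nat]_(n, m)) :=
  forall y : 'cV[R]_n, exists x : 'cV[R]_m, natmx R A *m x = y.

Definition inner (n : nat) (q v : 'cV[int]_n) : int :=
  \sum_(i < n) q i 0 * v i 0.

Definition norm1 (m : nat) (v : 'cV[nat]_m) : nat := (\sum_(k < m) v k ord0)%N.

Definition tie_breaking_rule (n m : nat) (A : 'M[nat]_(n, m))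
    (s : 'cV[int]_n -> 'cV[nat]_m) :=
  forall q : 'cV[int]_n,
    (norm1 (s q) <= 2)%N /\
    (forall v : 'cV[nat]_m, (norm1 v <= 2)%N ->
       inner q (natmx int (A *m v)) <= inner q (natmx int (A *m s q))).

Definition idle_clause (n m : nat) (A : 'M[nat]_(n, m))
    (s : 'cV[int]_n -> 'cV[nat]_m) :=
  forall q : 'cV[int]_n,
    (forall k : 'I_m, inner q (natmx int (col k A)) <= 0) -> s q = 0.

Definition normalize (R : realType) (n : nat) (lam : 'cV[R]_n) : 'cV[R]_n :=
  (\sum_(i < n) lam i 0)^-1 *: lam.

Section DiscreteProbability.
Context (d : measure_display) (T : measurableType d) (R : realType).
Variable P : probability T R.

(* Measurability for the power-set sigma-algebra on [S]; it is only used for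
   countable [S]. *)
Definition discrete_rv (S : Type) (X : T -> S) :=
  forall B : set S, measurable (X @^-1` B).

Definition independent (S S' : Type) (X : T -> S) (Y : T -> S') :=
  forall (B : set S) (C : set S'),
    P (X @^-1` B `&` Y @^-1` C) = (P (X @^-1` B) * P (Y @^-1` C))%E.

Definition mutually_independent (S : Type) (X : nat -> T -> S) :=
  forall (J : seq nat) (B : nat -> set S), uniq J ->
    P [set w | forall t, t \in J -> B t (X t w)] =
    (\big[*%E/1]_(t <- J) P (X t @^-1` B t))%E.

End DiscreteProbability.

Record virtual_chain (d : measure_display) (T : measurableType d)
    (R : realType) (n m : nat) (A : 'M[nat]_(n, m)) (lam : 'cV[R]_n)
    (s : 'cV[int]_n -> 'cV[nat]_m) (P : probability T R)
    (a Q : nat -> T -> 'cV[int]_n) : Prop := VirtualChain {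
  vc_measurable_a : forall t, discrete_rv (a t);
  vc_measurable_Q : forall t, discrete_rv (Q t);
  vc_values_a : forall t w, exists i : 'I_n, a t w = delta_mx i 0;
  vc_law_a : forall t (i : 'I_n),
    P [set w | a t w = delta_mx i 0] = (normalize lam i 0)%:E;
  vc_independent_a : mutually_independent P a;
  vc_nonanticipative : forall t,
    independent P (a t) (fun w => [ffun k : 'I_t.+1 => Q k w]);
  vc_step : forall t w,
    Q t.+1 w = Q t w + a t w - natmx int (A *m s (Q t w))
}.

(* In the next definitions [P x] is the law under which the process [Q] is
   started at [x]; expectations of [+oo]-valued return times are written as
   integrals because ['E_P] only takes real-valued functions. *)
Section MarkovFamily.
Context (d : measure_display) (T : measurableType d) (R : realType).
Variables (S : Type) (P : S -> probability T R) (Q : nat -> T -> S).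

(* [inf {t >= 1 : Q t = y}], equal to [+oo] if [y] is never hit. *)
Definition return_time (y : S) (w : T) : \bar R :=
  ereal_inf [set (t%:R)%:E | t in [set t : nat | (1 <= t)%N /\ Q t w = y]].

Definition mean_return_time (x : S) : \bar R :=
  (\int[P x]_w return_time x w)%E.

Definition positive_recurrent (x : S) := (mean_return_time x < +oo)%E.

Definition reachable (x : S) : set S :=
  [set y | exists t : nat, (0 < P x [set w | Q t w = y])%E].

Definition communicating_class (x : S) : set S :=
  [set y | reachable x y /\ reachable y x].

End MarkovFamily.

(* Main.v *)
Require Import Defs.
From mathcomp Require Import measurable_realfun ring lra zify.
Import Order.TTheory GRing.Theory Num.Theory.

Local Open Scope classical_set_scope.
Local Open Scope ring_scope.

(* By surjectivity of [A] and positivity of [mu], the squared norm is a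
   Foster-Lyapunov function: its drift is at most -1 off a finite set [F].
   Moreover 0 is reachable from every state: suitable arrivals make the total
   positive part of the queue, then the total negative part, decrease.  Hence
   the states reachable from 0 form its communicating class, and any such state
   [x] is reachable from every state of [F].  With
   [h_t q] the probability of avoiding [x] at times 1..t from [q] and [K] the
   transition operator killed at [x], one has [h_t = K^t 1]; correcting the
   squared norm by a combination of the [h_t] gives a nonnegative [U] with
   [K U <= U - 1], so that the mean return time [\sum_t h_t x] is at most
   [U x]. *)

(** * Survival probabilities of a chain killed at [x] *)

Section TabooChain.
Context {R : realFieldType} {I : finType} {S : eqType}.
Variables (p : I -> R) (step : S -> I -> S) (x : S).

Definition run : S -> seq I -> S := foldl step.

Definition taboo (f : S -> R) (q : S) : R :=
  \sum_i p i * (if step q i == x then 0 else f (step q i)).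

(* The probability, starting from [q], that [x] is avoided at times 1..t. *)
Definition survival (t : nat) : S -> R := iter t taboo (fun=> 1).

Lemma survivalS t q : survival t.+1 q = taboo (survival t) q.
Proof. by []. Qed.

Hypotheses (p_gt0 : forall i, 0 < p i) (p_sum1 : \sum_i p i = 1).

Lemma le_taboo f g : (forall q, f q <= g q) -> forall q, taboo f q <= taboo g q.
Proof.
move=> fg q; apply: ler_sum => i _; apply: ler_wpM2l; first exact: ltW.
by case: ifP.
Qed.

Lemma tabooD f g q : taboo (fun r => f r + g r) q = taboo f q + taboo g q.
Proof.
rewrite /taboo -big_split /=; apply: eq_bigr => i _; rewrite -mulrDr.
by case: ifP; rewrite ?addr0.
Qed.

Lemma tabooZ c f q : taboo (fun r => c * f r) q = c * taboo f q.
Proof.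
rewrite /taboo mulr_sumr; apply: eq_bigr => i _; rewrite mulrCA.
by case: ifP; rewrite ?mulr0.
Qed.

Lemma taboo_sum (J : Type) (r : seq J) (F : J -> S -> R) q :
  taboo (fun z => \sum_(j <- r) F j z) q = \sum_(j <- r) taboo (F j) q.
Proof.
elim: r => [|j r IH].
  rewrite big_nil /taboo big1 // => i _.
  by rewrite big_nil if_same mulr0.
rewrite big_cons -IH -tabooD /taboo; apply: eq_bigr => i _.
by rewrite big_cons.
Qed.

Lemma taboo_le_mean f q : (forall z, 0 <= f z) ->
  taboo f q <= \sum_i p i * f (step q i).
Proof.
move=> f0; apply: ler_sum => i _; apply: ler_wpM2l; first exact: ltW.
by case: ifP.
Qed.

Lemma taboo_ge0 f q : (forall z, 0 <= f z) -> 0 <= taboo f q.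
Proof.
move=> f0; apply: sumr_ge0 => i _; apply: mulr_ge0; first exact: ltW.
by case: ifP.
Qed.

Lemma survival_ge0 t q : 0 <= survival t q.
Proof. by elim: t q => [|t IH] q; [exact: ler01 | exact: taboo_ge0]. Qed.

Lemma survival_le1 t q : survival t q <= 1.
Proof.
elim: t q => [//|t IH] q; apply: le_trans (taboo_le_mean _ q (survival_ge0 t)) _.
rewrite -p_sum1; apply: ler_sum => i _.
by rewrite -[leRHS]mulr1; apply: ler_wpM2l; [exact: ltW | exact: IH].
Qed.

(** The word [u] has positive probability. Its first letter either enters [x], so that its term
    vanishes, or leaves a shorter nonempty word to the induction; every other letter contributes at
    most its own mass. *)
Lemma survival_lt1 u q : (0 < size u)%N -> run q u = x ->
  survival (size u) q < 1.
Proof.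
elim: u q => [//|i u IH] q _ ru; rewrite survivalS -p_sum1 /taboo.
rewrite (bigD1 i) //= [ltRHS](bigD1 i) //=; apply: ltr_leD.
  rewrite -[ltRHS]mulr1 ltr_pM2l //; case: eqVneq => // nx.
  apply: IH => //; case: u ru => //= eqx; by rewrite eqx eqxx in nx.
apply: ler_sum => j _; rewrite -[leRHS]mulr1; apply: ler_wpM2l; first exact: ltW.
by case: ifP => // _; exact: survival_le1.
Qed.

(* If from every state of the finite set [F] the taboo state [x] can be
   reached, the visits to [F] before [x] are controlled by the function
   [W = \sum_(z <- F) (1 - survival N_z z)^-1 * \sum_(j < N_z) survival j],
   because [taboo (survival j) = survival j.+1] makes the inner sum telescope;
   then [V + b W] has drift at most -1 for the taboo kernel. *)
Lemma foster_taboo (V : S -> R) (b : R) (F : seq S) :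
    (forall q, 0 <= V q) -> 0 <= b ->
    (forall q, \sum_i p i * V (step q i) <= V q - 1 + b * (q \in F)%:R) ->
    (forall q, q \in F -> exists2 u, (0 < size u)%N & run q u = x) ->
  forall q, exists C, forall t, \sum_(j < t) survival j q <= C.
Proof.
move=> V0 b0 drift reachx.
have /boolp.choice[N HN] : forall z : S, exists N : nat, z \in F -> survival N z < 1.
  move=> z; case: (boolP (z \in F)) => [/reachx[u u0 ru]|_]; last by exists 0%N.
  by exists (size u) => _; exact: survival_lt1.
pose c z : R := (1 - survival (N z) z)^-1.
have c0 z : 0 <= c z by rewrite invr_ge0 subr_ge0 survival_le1.
pose W q := \sum_(z <- F) c z * \sum_(j < N z) survival j q.
have W0 q : 0 <= W q.
  apply: sumr_ge0 => z _; apply: mulr_ge0 => //.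
  by apply: sumr_ge0 => j _; exact: survival_ge0.
have tabooW q : taboo W q <= W q - (q \in F)%:R.
  rewrite /W taboo_sum lerBrDr -lerBrDl -sumrB.
  have -> : \sum_(z <- F) (c z * \sum_(j < N z) survival j q -
       taboo (fun r => c z * \sum_(j < N z) survival j r) q) =
     \sum_(z <- F) c z * (1 - survival (N z) q).
    apply: eq_bigr => z _; rewrite tabooZ taboo_sum -mulrBr; congr (_ * _).
    elim: (N z) => [|k IHk]; first by rewrite !big_ord0 /= !subrr.
    by rewrite !big_ord_recr opprD addrACA IHk -survivalS addrA subrK.
  have pos z : 0 <= c z * (1 - survival (N z) q).
    by apply: mulr_ge0 => //; rewrite subr_ge0 survival_le1.
  case: (boolP (q \in F)) => [qF|_]; last by apply: sumr_ge0.
  (* The term [z = q] equals 1 by the choice of [c]; the others are nonnegative. *)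
  rewrite (big_rem q) //= {1}/c mulVf ?lerDl ?sumr_ge0 //.
  by rewrite subr_eq0 gt_eqF // HN.
pose U q := V q + b * W q.
have U0 q : 0 <= U q by rewrite addr_ge0 // mulr_ge0.
have tabooU q : taboo U q <= U q - 1.
  rewrite /U tabooD tabooZ.
  have := le_trans (taboo_le_mean V q V0) (drift q).
  have := ler_wpM2l b0 (tabooW q); rewrite mulrBr; lra.
(* [U q] bounds every partial sum: the sum of [t.+1] terms is 1 plus [taboo] of the sum of [t]
   terms, hence at most [1 + taboo U q <= U q]. *)
move=> q; exists (U q) => t; elim: t q => [|t IH] q; first by rewrite big_ord0.
rewrite big_ord_recl.
have -> : \sum_(i < t) survival (bump 0 i) q =
          taboo (fun r => \sum_(j < t) survival j r) q.
  by rewrite taboo_sum; apply: eq_bigr.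
rewrite [survival _ _]/=; have := le_taboo _ _ IH q; have := tabooU q; lra.
Qed.

End TabooChain.

(** * Maximizing service rules and the reachability of 0 *)

Section Queue.
Context {n m : nat}.
Variables (A : 'M[nat]_(n, m)) (s : 'cV[int]_n -> 'cV[nat]_m).

Definition queue_step (q : 'cV[int]_n) (i : 'I_n) : 'cV[int]_n :=
  q + delta_mx i 0 - natmx int (A *m s q).

Definition weight (q : 'cV[int]_n) (k : 'I_m) : int :=
  inner q (natmx int (col k A)).

Lemma weightE q k : weight q k = \sum_i q i 0 * (A i k)%:Z.
Proof. by apply: eq_bigr => i _; rewrite !mxE natz. Qed.

Lemma mulmx_natE (v : 'cV[nat]_m) r :
  (A *m v) r 0 = (\sum_k A r k * v k ord0)%N.
Proof. by rewrite mxE. Qed.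

Lemma queue_stepE q i r :
  queue_step q i r 0 = q r 0 + (r == i)%:Z - ((A *m s q) r 0)%:Z.
Proof. by rewrite /queue_step !mxE eqxx andbT !natz. Qed.

Lemma inner_mulmx q v :
  inner q (natmx int (A *m v)) = \sum_k (v k 0)%:Z * weight q k.
Proof.
under eq_bigr => k _ do rewrite weightE mulr_sumr.
rewrite exchange_big /=; apply: eq_bigr => i _.
rewrite mxE mulmx_natE natr_sum mulr_sumr; apply: eq_bigr => k _.
by rewrite natrM !natz; ring.
Qed.

Hypotheses (s_rule : tie_breaking_rule A s) (s_idle : idle_clause A s).

Definition payoff q := inner q (natmx int (A *m s q)).

Lemma payoff_ge0 q : 0 <= payoff q.
Proof.
have [_ /(_ (const_mx 0%N))] := s_rule q.
rewrite inner_mulmx big1; last by move=> k _; rewrite mxE mul0r.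
by apply; rewrite /norm1 big1 // => k _; rewrite mxE.
Qed.

(** Putting both units of service on column [k] is an admissible competitor. *)
Lemma payoff_ge q k : 2 * weight q k <= payoff q.
Proof.
have [_ /(_ (\col_l (2 * (l == k))%N))] := s_rule q.
rewrite inner_mulmx (bigD1 k) //= big1 => [|l /negbTE lk]; last first.
  by rewrite mxE lk muln0 mul0r.
rewrite mxE eqxx muln1 addr0; apply.
rewrite /norm1 (bigD1 k) //= big1 => [|l /negbTE lk]; last first.
  by rewrite mxE lk muln0.
by rewrite mxE eqxx.
Qed.

Lemma service_le2 q k : (s q k ord0 <= 2)%N.
Proof.
by have [+ _] := s_rule q; apply: leq_trans; rewrite /norm1 (bigD1 k) //= leq_addr.
Qed.

Lemma sumz_gt0 (J : finType) (F : J -> int) :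
  0 < \sum_j F j -> exists j, 0 < F j.
Proof.
move=> F0; have [/existsP//|] := boolP [exists j, 0 < F j].
rewrite negb_exists => /forallP H; move: F0; rewrite ltNge => /negP[].
by apply: sumr_le0 => j _; rewrite leNgt.
Qed.

Lemma natz_mul_gt0 (c : nat) (w : int) : 0 < c%:Z * w -> (0 < c)%N /\ 0 < w.
Proof. by case: c => [|c]; rewrite ?mul0r // pmulr_rgt0. Qed.

(* Both units of service go to columns of positive weight: as the payoff [D]
   is at least twice any weight [z], removing one unit leaves [D - z > 0]. *)
Lemma service_positive q k0 : 0 < weight q k0 ->
  exists i j, 0 < q j 0 /\
    forall r, ((r == i) + (r == j) <= (A *m s q) r 0%R)%N.
Proof.
move=> wk0; have D0 : 0 < payoff q.
  by apply: lt_le_trans (payoff_ge q k0); lia.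
have pick_row k : 0 < weight q k -> exists i, 0 < q i 0 /\ (0 < A i k)%N.
  by rewrite weightE => /sumz_gt0[i]; rewrite mulrC => /natz_mul_gt0[]; exists i.
have := D0; rewrite /payoff inner_mulmx => /sumz_gt0[k sk].
have {sk}[sk0 wk] := natz_mul_gt0 _ _ sk.
have : 0 < \sum_l (s q l ord0 - (l == k))%N%:Z * weight q l.
  have -> : \sum_l (s q l ord0 - (l == k))%N%:Z * weight q l =
            payoff q - weight q k.
    rewrite /payoff inner_mulmx (bigD1 k) //= [in RHS](bigD1 k) //= eqxx.
    rewrite -subzn // mulrBl mul1r [RHS]addrAC; congr (_ + _).
    by apply: eq_bigr => l /negbTE ->; rewrite subn0.
  by have := payoff_ge q k; lia.
move=> /sumz_gt0[l] /natz_mul_gt0[sl wl].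
have [i [_ Ai]] := pick_row k wk.
have [j [qj Aj]] : exists j, 0 < q j 0 /\ (0 < A j l)%N by exact: pick_row.
exists i, j; split=> // r; rewrite mulmx_natE.
have ri : ((r == i) <= A r k)%N by case: eqVneq => [->|].
have rj : ((r == j) <= A r l)%N by case: eqVneq => [->|].
apply: leq_trans (leq_add ri rj) _.
(* If [l = k], this column is served at least twice, and its contribution [2 * A r k] covers both
   indicators. *)
have [kl|kl] := eqVneq l k.
  rewrite kl eqxx subn_gt0 in sl *; rewrite (bigD1 k) //= addnn -muln2.
  by apply: leq_trans (leq_addr _ _); rewrite leq_mul2l sl orbT.
rewrite (negbTE kl) subn0 in sl.
rewrite (bigD1 k) //= (bigD1 l) //= addnA.
by apply: leq_trans (leq_addr _ _); apply: leq_add; apply: leq_pmulr.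
Qed.

Definition posmass (q : 'cV[int]_n) : nat := (\sum_i `|Num.max (q i 0%R) 0%R|)%N.
Definition negmass (q : 'cV[int]_n) : nat := (\sum_i `|Num.min (q i 0%R) 0%R|)%N.

Lemma sum_ltn (J : finType) (F G : J -> nat) j :
  (forall i, F i <= G i)%N -> (F j < G j)%N -> (\sum_i F i < \sum_i G i)%N.
Proof.
move=> FG FGj; rewrite (bigD1 j) //= [ltnRHS](bigD1 j) //= -addSn.
by apply: leq_add => //; apply: leq_sum.
Qed.

Hypothesis row_neq0 : forall i, exists k, (0 < A i k)%N.

(* Lexicographic descent on (posmass, negmass), the arrival being chosen as
   the first row of [service_positive] or, in an idle state, as a negative
   coordinate. *)
Lemma reach0 (q : 'cV[int]_n) : exists u, run queue_step q u = 0.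
Proof.
have [N] := ubnP (posmass q); elim: N q => // N IHN q; rewrite ltnS => qN.
have [M] := ubnP (negmass q); elim: M q qN => // M IHM q qN; rewrite ltnS => qM.
have next i : (exists u, run queue_step (queue_step q i) u = 0) ->
              exists u, run queue_step q u = 0 by case=> u <-; exists (i :: u).
have [/existsP[k wk]|] := boolP [exists k, 0 < weight q k].
  (* The service absorbs the arrival at [i] and still removes a unit at [j], where [q] is positive;
     no other coordinate grows. *)
  have [i [j [qj Hr]]] := service_positive q k wk.
  apply: (next i); apply: IHN; apply: leq_trans qN.
  apply: (@sum_ltn _ _ _ j) => [r|].
    by have := Hr r; rewrite queue_stepE; case: (r == i); case: (r == j); lia.
  by have := Hr j; rewrite queue_stepE eqxx; case: (j == i); lia.
rewrite negb_exists => /forallP noserve.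
have wle0 k : weight q k <= 0 by rewrite leNgt.
have sq0 : s q = 0 by apply: s_idle.
have stepE i r : queue_step q i r 0 = q r 0 + (r == i)%:Z.
  by rewrite queue_stepE sq0 mulmx0 mxE subr0.
(* An arrival at a negative integer coordinate keeps its positive part at 0 and shrinks its negative
   part. *)
have [/existsP[i qi]|] := boolP [exists i, q i 0 < 0].
  apply: (next i); apply: IHM.
    apply: leq_trans qN; apply: leq_sum => r _.
    by rewrite stepE; case: eqVneq => [->|]; lia.
  apply: leq_trans qM; apply: (@sum_ltn _ _ _ i) => [r|].
    by rewrite stepE; case: eqVneq => [->|]; lia.
  by rewrite stepE eqxx; lia.
rewrite negb_exists => /forallP nonneg.
have q0 i : 0 <= q i 0 by rewrite leNgt.
exists [::]; apply/matrixP => i j; rewrite ord1 mxE /=.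
(* As [q] is nonnegative, a positive [q i 0] would give positive weight to any column meeting row
   [i]. *)
have [k Aik] := row_neq0 i.
apply/eqP; rewrite eq_le q0 andbT leNgt; apply/negP => qi0.
have := wle0 k; rewrite weightE (bigD1 i) //= leNgt => /negP[].
by rewrite ltr_wpDr ?mulr_gt0 // sumr_ge0 // => r _; rewrite mulr_ge0.
Qed.

End Queue.

(** * Drift of the squared norm *)

Section Drift.
Context {R : realType} {n m : nat}.
Variables (A : 'M[nat]_(n, m)) (s : 'cV[int]_n -> 'cV[nat]_m).
Variables (p : 'cV[R]_n) (nu : 'cV[R]_m).
Hypothesis s_rule : tie_breaking_rule A s.
Hypothesis col_neq0 : forall k, exists i, (0 < A i k)%N.
Hypothesis A_surj : surjective_mx R A.
Hypotheses (p_ge0 : forall i, 0 <= p i 0) (p_sum1 : \sum_i p i 0 = 1).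
Hypotheses (nu_gt0 : forall k, 0 < nu k 0) (A_nu : natmx R A *m nu = p).

(** A nonzero column of natural numbers has sum at least 1, so the total mass of [A nu = p]
    dominates that of [nu]. *)
Lemma sum_nu_le1 : \sum_k nu k 0 <= 1.
Proof.
rewrite -p_sum1 -A_nu; under [leRHS]eq_bigr => i _ do rewrite mxE.
rewrite exchange_big /=; apply: ler_sum => k _.
have [i Aik] := col_neq0 k; rewrite (bigD1 i) //= mxE.
rewrite -[leLHS]mul1r -[leLHS]addr0 lerD //.
  by rewrite ler_pM2r // ler1n.
by apply: sumr_ge0 => r _; rewrite mxE mulr_ge0 // ltW.
Qed.

(** Adjunction between [A] and its transpose, used for [y = nu] and for preimages of the unit
    vectors. *)
Lemma inner_mulmx_real (q : 'cV[int]_n) (y : 'cV[R]_m) (v : 'cV[R]_n) : natmx R A *m y = v ->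
  \sum_i (q i 0)%:~R * v i 0 = \sum_k y k 0 * (weight A q k)%:~R.
Proof.
move=> <-; under [RHS]eq_bigr => k _ do rewrite weightE rmorph_sum mulr_sumr.
rewrite exchange_big /=; apply: eq_bigr => i _.
rewrite mxE mulr_sumr; apply: eq_bigr => k _.
by rewrite mxE intrM -pmulrn; ring.
Qed.

(* The payoff is at least [2 z] for each weight [z], hence at least
   [\sum_k nu_k (z_k + |z_k|)]. *)
Lemma inner_drift (q : 'cV[int]_n) :
  \sum_i (q i 0)%:~R * p i 0 - (payoff A s q)%:~R <=
  - \sum_k nu k 0 * `|(weight A q k)%:~R|.
Proof.
rewrite (inner_mulmx_real q _ _ A_nu) lerBlDr addrC lerBrDr -big_split /=.
set D : R := (payoff A s q)%:~R.
have D0 : 0 <= D by rewrite ler0z payoff_ge0.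
apply: (@le_trans _ _ (\sum_k nu k 0 * D)); last first.
  by rewrite -mulr_suml ler_piMl // sum_nu_le1.
apply: ler_sum => k _; rewrite -mulrDr ler_wpM2l ?(ltW (nu_gt0 k)) //.
have : 2 * (weight A q k)%:~R <= D.
  by rewrite -[2]/(2%:~R) -intrM ler_int payoff_ge.
case: ger0P; lra.
Qed.

(** By surjectivity each unit vector is some [A y_i], so [q_i] is a combination of the weights;
    dividing its coefficients by [nu_k > 0] gives [X]. Hence small weights confine [q] to a box. *)
Lemma coord_le : exists2 X : R, 0 <= X & forall (q : 'cV[int]_n) i,
  `|(q i 0)%:~R| <= X * \sum_k nu k 0 * `|(weight A q k)%:~R|.
Proof.
have /boolp.choice[y Ay] := fun i : 'I_n => A_surj (delta_mx i 0).
have pos i k : 0 <= `|y i k 0| / nu k 0.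
  by rewrite divr_ge0 // ltW.
exists (\sum_i \sum_k `|y i k 0| / nu k 0).
  by do 2!apply: sumr_ge0 => ? _.
move=> q i; have := inner_mulmx_real q _ _ (Ay i).
rewrite (bigD1 i) //= mxE !eqxx mulr1 big1 ?addr0 => [->|r /negbTE ri]; last first.
  by rewrite mxE ri mulr0.
rewrite (le_trans (ler_norm_sum _ _ _)) // mulr_sumr; apply: ler_sum => k _.
rewrite normrM -[X in X * _](divfK (lt0r_neq0 (nu_gt0 k))) -!mulrA mulrA.
apply: ler_wpM2r; first by rewrite mulr_ge0 // ltW.
rewrite (bigD1 i) //= (bigD1 k) //= -addrA lerDl addr_ge0 //.
  by apply: sumr_ge0.
by do 2!apply: sumr_ge0 => ? _.
Qed.

Definition sqnorm (q : 'cV[int]_n) : R := \sum_i (q i 0)%:~R ^+ 2.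

(** Expanding the square leaves, besides the cross term, at most [1 + w_r ^+ 2] in coordinate [r];
    [w_r] is at most [B r] because no column is served more than twice. *)
Lemma sqnorm_step : exists2 C : R, 0 <= C & forall q : 'cV[int]_n,
  \sum_i p i 0 * sqnorm (queue_step A s q i) <=
  sqnorm q + 2 * (\sum_i (q i 0)%:~R * p i 0 - (payoff A s q)%:~R) + C.
Proof.
pose B r : R := ((\sum_k A r k * 2)%N%:R).
exists (\sum_r (1 + B r ^+ 2)) => [|q].
  by apply: sumr_ge0 => r _; rewrite addr_ge0 // sqr_ge0.
pose w r : R := ((A *m s q) r 0)%:R.
have w0 r : 0 <= w r by [].
have wB r : w r <= B r.
  rewrite ler_nat mulmx_natE; apply: leq_sum => k _.
  by rewrite leq_mul2l (service_le2 A s s_rule) orbT.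
have payE : (payoff A s q)%:~R = \sum_r (q r 0)%:~R * w r.
  rewrite /payoff /inner rmorph_sum; apply: eq_bigr => r _.
  by rewrite /= intrM mxE natz -pmulrn.
have one i : sqnorm (queue_step A s q i) <=
    sqnorm q + 2 * ((q i 0)%:~R - (payoff A s q)%:~R) + \sum_r (1 + B r ^+ 2).
  have qi : (q i 0)%:~R = \sum_r (q r 0)%:~R * (r == i)%:R :> R.
    rewrite (bigD1 i) //= eqxx mulr1 big1 ?addr0 // => r /negbTE ->.
    by rewrite mulr0.
  rewrite payE {1}qi -sumrB mulr_sumr -!big_split; apply: ler_sum => r _ /=.
  rewrite queue_stepE intrB intrD -!pmulrn -/(w r).
  have := wB r; have := w0 r; case: (r == i) => /=; nra.
apply: (@le_trans _ _ (\sum_i p i 0 * (sqnorm q +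
    2 * ((q i 0)%:~R - (payoff A s q)%:~R) + \sum_r (1 + B r ^+ 2)))).
  by apply: ler_sum => i _; rewrite ler_wpM2l.
under eq_bigr => i _.
  have -> : p i 0 * (sqnorm q + 2 * ((q i 0)%:~R - (payoff A s q)%:~R) +
      \sum_r (1 + B r ^+ 2)) = 2 * ((q i 0)%:~R * p i 0) + p i 0 * (sqnorm q -
      2 * (payoff A s q)%:~R + \sum_r (1 + B r ^+ 2)) by ring.
  over.
by rewrite big_split /= -mulr_suml p_sum1 -mulr_sumr; lra.
Qed.

Lemma finite_box (K : nat) : exists F : seq 'cV[int]_n, forall q : 'cV[int]_n,
  (forall i, `|q i 0%R| <= K)%N -> q \in F.
Proof.
exists [seq \col_i ((f i)%:Z - K%:Z) | f : {ffun 'I_n -> 'I_(2 * K).+1}] => q qK.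
apply/mapP; exists [ffun i => inord `|(q i 0 + K%:Z)%R|%N]; first by rewrite mem_enum.
apply/matrixP => i j; rewrite ord1 !mxE ffunE inordK; have := qK i; first move: (q i 0); lia.
Qed.

Lemma sqnorm_drift : exists b : R, exists2 F : seq 'cV[int]_n, 0 <= b &
  forall q : 'cV[int]_n, \sum_i p i 0 * sqnorm (queue_step A s q i) <=
            sqnorm q - 1 + b * (q \in F)%:R.
Proof.
have [C C0 HC] := sqnorm_step; have [X X0 HX] := coord_le.
(* If the weighted sum [Z] is at most [C + 1], [coord_le] puts [q] in this box. Outside it the drift
   is at most [C - 2 Z < -1]; inside it is at most [C], whence [b = C + 1]. *)
have [F HF] := finite_box (Num.Def.archi_bound (X * (C + 1))).
exists (C + 1), F => [|q]; first by rewrite addr_ge0.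
have := HC q; have := inner_drift q.
set Z := \sum_k nu k 0 * _; set D := _ - (payoff A s q)%:~R => DZ sq.
have Z0 : 0 <= Z by apply: sumr_ge0 => k _; rewrite mulr_ge0 // ltW.
have [qF|qF] := boolP (q \in F); first by rewrite mulr1; lra.
suff : C + 1 < Z by rewrite mulr0; lra.
rewrite ltNge; apply: contra qF => ZC; apply: HF => i.
rewrite -(ler_nat R) natr_absz intr_norm; apply: le_trans (HX q i) _.
apply: le_trans (ler_wpM2l X0 ZC) _; rewrite ltW //.
by apply: archi_boundP; rewrite mulr_ge0 // addr_ge0.
Qed.

End Drift.

(** * The return time as a series of indicators *)

Section ReturnTime.
Context {R : realType} {d : measure_display} {T : measurableType d} {S : Type}.
Variables (Q : nat -> T -> S) (x : S).

(** Time [k] is excluded: [avoid 0 t] then means that the return time exceeds [t], and for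
    [k = size u] the window opens just after the arrivals of a word [u] have acted. *)
Definition avoid (k t : nat) : set T :=
  [set w | forall j, (k < j <= k + t)%N -> Q j w <> x].

Lemma sum_indic_avoid_le (t k : nat) w : (0 < t)%N -> Q t w = x ->
  \sum_(j < k) (\1_(avoid 0 j) w : R) <= (minn k t)%:R.
Proof.
move=> t0 Qt; elim: k => [|k IH]; first by rewrite big_ord0 min0n.
rewrite big_ord_recr /=.
have [kt|tk] := ltnP k t.
  rewrite (minn_idPl (ltnW kt)) in IH.
  by rewrite (minn_idPl kt) -natr1 lerD // indicE lern1 leq_b1.
rewrite (minn_idPr (leqW tk)) indicE memNset ?addr0; last first.
  by move=> /(_ t); rewrite t0 add0n tk => /(_ isT).
by rewrite (minn_idPr tk) in IH.
Qed.

Lemma sum_indic_avoid_eq (k : nat) w :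
  (forall j, (0 < j < k)%N -> Q j w <> x) ->
  \sum_(j < k) (\1_(avoid 0 j) w : R) = k%:R.
Proof.
move=> Hk; rewrite (eq_bigr (fun=> 1)) => [|i _].
  by rewrite sumr_const card_ord.
rewrite indicE mem_set // => j /andP[j0 ji]; apply: Hk.
by rewrite j0 (leq_ltn_trans ji (ltn_ord i)).
Qed.

(** A time with values in the naturals or infinity is the sum over [t] of the indicators that it
    exceeds [t]. *)
Lemma return_timeE w :
  return_time R Q x w = (\sum_(0 <= t <oo) (\1_(avoid 0 t) w)%:E)%E.
Proof.
have ind0 j : (0 <= (\1_(avoid 0 j) w : R)%:E)%E by rewrite lee_fin.
have partial k : (\sum_(0 <= j < k) (\1_(avoid 0 j) w)%:E)%E =
    (\sum_(j < k) (\1_(avoid 0 j) w : R))%:E.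
  by rewrite big_mkord sumEFin.
apply/eqP; rewrite eq_le; apply/andP; split; last first.
  apply: le_ereal_inf_tmp => _ [t [t0 Qt] <-]; apply: lime_le.
    exact: is_cvg_nneseries.
  apply: nearW => k; rewrite partial lee_fin.
  by apply: le_trans (sum_indic_avoid_le t k w t0 Qt) _; rewrite ler_nat geq_minr.
have ge k : (forall j, (0 < j < k)%N -> Q j w <> x) ->
    (k%:R%:E <= \sum_(0 <= t <oo) (\1_(avoid 0 t) w : R)%:E)%E.
  move=> Hk; rewrite -(sum_indic_avoid_eq k w Hk) -partial.
  exact: nneseries_lim_ge.
have [[t [t0 Qt]]|never] := pselect (exists t, (0 < t)%N /\ Q t w = x).
  have ex : exists t, (0 < t)%N && `[< Q t w = x >].
    by exists t; rewrite t0; apply/asboolP.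
  case: (ex_minnP ex) => k /andP[k0 /asboolP Qk] kmin.
  apply: (@le_trans _ _ k%:R%:E); first by apply: ereal_inf_lbound; exists k.
  apply: ge => j /andP[j0 jk] Qj; have := kmin j.
  by rewrite j0 leqNgt jk asboolT // => /(_ isT).
(* Without a return every indicator is 1, so the series exceeds every natural number. *)
rewrite [leRHS](_ : _ = +oo%E) ?leey //; apply: eq_infty => r.
apply: (@le_trans _ _ (Num.Def.archi_bound `|r|)%:R%:E).
  by rewrite lee_fin (le_trans (ler_norm r)) // ltW // archi_boundP.
by apply: ge => j /andP[j0 _] Qj; apply: never; exists j.
Qed.

End ReturnTime.

(** * The law of the chain through its arrival words *)

Section ChainLaw.
Context {R : realType} {n m : nat} {A : 'M[nat]_(n, m)} {lam : 'cV[R]_n}.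
Context {s : 'cV[int]_n -> 'cV[nat]_m}.
Context {d : measure_display} {T : measurableType d} {P : probability T R}.
Context {a Q : nat -> T -> 'cV[int]_n} {x : 'cV[int]_n}.
Hypothesis chain : virtual_chain A lam s P a Q.
Hypothesis start : P [set w | Q 0%N w = x] = 1%E.

Let p i := normalize lam i 0.
Let step := queue_step A s.
Let unit_vec (i : 'I_n) : 'cV[int]_n := delta_mx i 0.

Lemma unit_vec_inj : injective unit_vec.
Proof.
move=> i j /matrixP /(_ i 0); rewrite !mxE !eqxx.
by case: eqVneq.
Qed.

Definition arrivals (u : seq 'I_n) : set T :=
  [set w | forall j, (j < size u)%N -> a j w = nth 0 (map unit_vec u) j].

Lemma chain_step t w i : a t w = unit_vec i -> Q t.+1 w = step (Q t w) i.
Proof. by move=> ai; rewrite (vc_step chain) ai. Qed.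

Lemma arrivals_rcons u i :
  arrivals (rcons u i) = arrivals u `&` (a (size u) @^-1` [set unit_vec i]).
Proof.
apply/seteqP; split=> w; rewrite /arrivals /= size_rcons map_rcons.
  move=> H; split=> [j ju|].
    by have := H j (ltnW ju); rewrite nth_rcons size_map ju.
  by have := H _ (ltnSn _); rewrite nth_rcons size_map ltnn eqxx.
move=> [H Hi] j; rewrite ltnS leq_eqVlt nth_rcons size_map.
by case: ltngtP => //= [ju _|-> //]; exact: H.
Qed.

Lemma run_arrivals u w : Q 0%N w = x -> arrivals u w ->
  Q (size u) w = run step x u.
Proof.
move=> Q0; elim/last_ind: u => [//|u i IH].
rewrite arrivals_rcons => -[/IH Qu ai].
by rewrite size_rcons (chain_step _ _ _ ai) Qu /run foldl_rcons.
Qed.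

Lemma measurable_arrivals u : measurable (arrivals u).
Proof.
elim/last_ind: u => [|u i IH]; last first.
  by rewrite arrivals_rcons; apply: measurableI => //; apply: vc_measurable_a chain _ _.
rewrite (_ : arrivals [::] = setT) //.
by apply/seteqP; split.
Qed.

Lemma measurable_avoid k t : measurable (avoid Q x k t).
Proof.
elim: t => [|t IH].
  rewrite (_ : avoid _ _ _ _ = setT) //.
  by apply/seteqP; split=> // w _ j; rewrite addn0; case: ltngtP.
rewrite (_ : avoid _ _ _ _ = avoid Q x k t `&` Q (k + t.+1)%N @^-1` [set~ x]).
  by apply: measurableI => //; apply: vc_measurable_Q chain _ _.
apply/seteqP; split=> w /=.
  move=> H; split=> [j /andP[kj jt]|]; apply: H; lia.
move=> [H Ht] j /andP[kj jt].
have [->//|jt'] := eqVneq j (k + t.+1)%N.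
apply: H; lia.
Qed.

(** The start is prescribed only almost surely; this allows pathwise identities to be used on the
    event that it holds. *)
Lemma prob_start E : measurable E -> P ([set w | Q 0%N w = x] `&` E) = P E.
Proof.
have mS : measurable [set w | Q 0%N w = x].
  exact: (vc_measurable_Q chain 0%N [set x]).
move=> mE; rewrite setIC [RHS](measureDI P mE mS).
rewrite [X in (X + _)%E](_ : _ = 0%E) ?add0e //.
apply: (@subset_measure0 _ _ _ P _ (~` [set w | Q 0%N w = x])).
- exact: measurableD.
- exact: measurableC.
- by move=> w [].
- by apply: etrans (probability_setC P mS) _; rewrite start subee.
Qed.

Lemma prob_arrivals u : P (arrivals u) = (\prod_(i <- u) p i)%:E.
Proof.
have := vc_independent_a chain (fun j => [set nth 0 (map unit_vec u) j])
  (iota_uniq 0 (size u)).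
rewrite (_ : [set w | _] = arrivals u) => [->|]; last first.
  by apply/seteqP; split=> w H j ju; apply: H; move: ju; rewrite mem_iota.
case: u => [|i0 u]; first by rewrite !big_nil.
rewrite (big_nth i0) -prodEFin /index_iota subn0.
apply: eq_big_seq => j; rewrite mem_iota add0n leq0n andTb => ju.
by rewrite (nth_map i0 0 unit_vec ju) -(vc_law_a chain j).
Qed.

Lemma prob_split E t : measurable E ->
  P E = (\sum_(i < n) P (E `&` (a t @^-1` [set unit_vec i])))%E.
Proof.
move=> mE; have mEi (i : 'I_n) : measurable (E `&` (a t @^-1` [set unit_vec i])).
  by apply: measurableI => //; apply: vc_measurable_a chain _ _.
rewrite -(measure_bigsetU_ord P xpredT) //; last first.
  move=> i j _ _ [w [[_ ai] [_ aj]]].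
  by apply: unit_vec_inj; rewrite -ai -aj.
congr (P _); rewrite -bigcup_seq; apply/seteqP; split=> [w Ew|w [i _ []]//].
have [i ai] := vc_values_a chain t w.
by exists i; rewrite /= ?mem_index_enum.
Qed.

(** The Markov property on cylinders. Induction on [t] for all words [u] at once: splitting on the
    next arrival extends [u] by a letter and reproduces the recursion of [survival]. *)
Lemma prob_avoid_after u t :
  P ([set w | Q 0%N w = x] `&` (arrivals u `&` avoid Q x (size u) t)) =
  ((\prod_(i <- u) p i) * survival p step x t (run step x u))%:E.
Proof.
have mE v r : measurable (arrivals v `&` avoid Q x (size v) r).
  by apply: measurableI; [exact: measurable_arrivals | exact: measurable_avoid].
elim: t u => [|t IH] u.
  rewrite prob_start // mulr1 -prob_arrivals; congr (P _).
  apply/seteqP; split=> [w []//|w uw]; split=> // j.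
  by rewrite addn0; case: ltngtP.
rewrite prob_start // (prob_split _ (size u)) // survivalS mulr_sumr -sumEFin.
apply: eq_bigr => i _.
have mEi : measurable (arrivals u `&` avoid Q x (size u) t.+1 `&`
    (a (size u) @^-1` [set unit_vec i])).
  by apply: measurableI => //; apply: vc_measurable_a chain _ _.
rewrite -prob_start //.
have Qi w : Q 0%N w = x -> arrivals u w -> a (size u) w = unit_vec i ->
    Q (size u).+1 w = step (run step x u) i.
  by move=> Q0 uw ai; rewrite (chain_step _ _ _ ai) (run_arrivals u).
(* If the next letter leads to [x], the avoidance event is empty and the killed term is 0. *)
case: eqVneq => [stepx|stepx].
  rewrite !mulr0 [X in P X](_ : _ = set0) ?measure0 //.
  apply/seteqP; split=> // w.
  move=> /= [Q0 [[uw av] ai]]; apply: (av (size u).+1); last by rewrite Qi.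
  by rewrite ltnSn addnS ltnS leq_addr.
have <- : run step x (rcons u i) = step (run step x u) i.
  by rewrite /run foldl_rcons.
have prodE : (\prod_(j <- u) p j) * p i = \prod_(j <- rcons u i) p j.
  by rewrite -cats1 big_cat big_seq1.
(* Both windows end at the same time; the longer one also contains time [(size u).+1], at which
   [stepx] excludes [x]. *)
rewrite mulrA prodE -IH; congr (P _); rewrite arrivals_rcons size_rcons.
apply/seteqP; split=> w /= [Q0 [[uw av] ai]]; (split=> //; split=> //).
- by move=> j /andP[uj jt]; apply: av; lia.
- split=> // j /andP[uj jt]; have [->|ju] := eqVneq j (size u).+1.
    by rewrite Qi //; apply/eqP.
  by apply: ai; lia.
Qed.

(** Integrating the indicator series termwise turns the mean return time into the sum of the
    survival probabilities. *)
Lemma mean_return_lty (C : R) :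
  (forall t, \sum_(j < t) survival p step x j x <= C) ->
  (\int[P]_w return_time R Q x w < +oo)%E.
Proof.
move=> HC; under eq_integral do rewrite return_timeE.
have mA t : measurable (avoid Q x 0 t) by exact: measurable_avoid.
rewrite integral_nneseries //; last first.
  by move=> t; apply/measurable_EFinP; exact: measurable_indic.
have probE t : (\int[P]_w (\1_(avoid Q x 0 t) w)%:E)%E =
               (survival p step x t x)%:E.
  rewrite integral_indic // setIT; apply: etrans (esym (prob_start _ (mA t))) _.
  have := prob_avoid_after [::] t; rewrite big_nil mul1r => <-.
  congr (P _); congr (_ `&` _); apply/seteqP; split=> [w av|w []//].
  by split.
under eq_eseriesr do rewrite probE.
apply: (@le_lt_trans _ _ C%:E); last exact: ltry.
apply: lime_le.
  apply: is_cvg_nneseries => t _ _.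
  by rewrite -probE integral_ge0 // => w _; rewrite lee_fin.
by apply: nearW => t; rewrite big_mkord sumEFin lee_fin.
Qed.

Lemma prob_run_gt0 u : (forall i, 0 < p i) ->
  (0 < P [set w | Q (size u) w = run step x u])%E.
Proof.
move=> p0; apply: (@lt_le_trans _ _ (P (arrivals u))).
  by rewrite prob_arrivals lte_fin prodr_gt0.
rewrite -prob_start; last exact: measurable_arrivals.
apply: le_measure; rewrite ?inE.
- apply: measurableI; last exact: measurable_arrivals.
  exact: (vc_measurable_Q chain 0%N [set x]).
- exact: (vc_measurable_Q chain _ [set run step x u]).
- by move=> w [/= Q0 uw]; exact: run_arrivals.
Qed.

Lemma exists_run w t : Q 0%N w = x -> exists u, run step x u = Q t w.
Proof.
move=> Q0; elim: t => [|t [u ru]]; first by exists [::].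
have [i ai] := vc_values_a chain t w; exists (rcons u i).
by rewrite (chain_step _ _ _ ai) -ru /run foldl_rcons.
Qed.

(** An event of positive probability meets the almost sure start, and the arrivals along a common
    sample path spell the word. *)
Lemma run_of_prob_gt0 t y :
  (0 < P [set w | Q t w = y])%E -> exists u, run step x u = y.
Proof.
rewrite -prob_start; last exact: (vc_measurable_Q chain t [set y]).
have [->|/set0P[w [/= Q0 <-]] _] := eqVneq
  ([set w | Q 0%N w = x] `&` [set w | Q t w = y]) set0.
  by rewrite measure0 ltxx.
exact: exists_run.
Qed.

End ChainLaw.

(** * Consequences of the hypotheses on [A], and the conclusion *)

Lemma surjective_row_neq0 (R : realType) (n m : nat) (A : 'M[nat]_(n, m)) :
  surjective_mx R A -> forall i, exists k, (0 < A i k)%N.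
Proof.
move=> surj i; have [y Ay] := surj (delta_mx i 0).
have [/existsP//|] := boolP [exists k, (0 < A i k)%N].
rewrite negb_exists => /forallP Ai0.
have /matrixP/(_ i 0) := Ay; rewrite !mxE !eqxx big1 => [/eqP|k _].
  by rewrite eq_sym oner_eq0.
by have := Ai0 k; rewrite lt0n negbK mxE => /eqP ->; rewrite mul0r.
Qed.

Lemma col_neq0_gt0 (n m : nat) (A : 'M[nat]_(n, m)) (k : 'I_m) :
  col k A <> 0 -> exists i, (0 < A i k)%N.
Proof.
move=> Ak; have [/existsP//|] := boolP [exists i, (0 < A i k)%N].
rewrite negb_exists => /forallP Ai0; case: Ak; apply/matrixP => i j.
by have := Ai0 i; rewrite lt0n negbK !mxE => /eqP ->.
Qed.

Theorem proposition5p2 (R : realType) (n m : nat)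
    (A : 'M[nat]_(n, m)) (lam : 'cV[R]_n)
    (A_col_neq0 : forall k : 'I_m, col k A <> 0)
    (lam_gt0 : forall i : 'I_n, 0 < lam i 0)
    (A_surj : surjective_mx R A)
    (A_mu : exists mu : 'cV[R]_m,
       (forall k : 'I_m, 0 < mu k 0) /\ natmx R A *m mu = lam)
    (s : 'cV[int]_n -> 'cV[nat]_m)
    (s_rule : tie_breaking_rule A s)
    (s_idle : idle_clause A s)
    (d : measure_display) (T : measurableType d)
    (P : 'cV[int]_n -> probability T R)
    (a Q : nat -> T -> 'cV[int]_n)
    (Q_chain : forall x : 'cV[int]_n, virtual_chain A lam s (P x) a Q)
    (Q_start : forall x : 'cV[int]_n, P x [set w | Q 0%N w = x] = 1%E) :
  [/\ communicating_class P Q 0 = reachable P Q 0,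
      (forall x : 'cV[int]_n, communicating_class P Q 0 x ->
         positive_recurrent P Q x) &
      (mean_return_time P Q 0%R < +oo)%E].
Proof.
(* A probability space has a point, and an arrival there is a unit vector; its index [i0] shows that
   [n > 0], so the total rate can be inverted. *)
have [w0 _] : exists w0 : T, setT w0.
  apply/set0P/eqP => T0; have := probability_setT (P 0).
  by rewrite T0 measure0 => /esym/eqP; rewrite onee_eq0.
have [i0 _] := vc_values_a (Q_chain 0) 0%N w0.
have L0 : 0 < \sum_i lam i 0.
  by rewrite (bigD1 i0) //= ltr_pwDl // sumr_ge0 // => i _; exact: ltW.
pose p i := normalize lam i 0.
have p_gt0 i : 0 < p i by rewrite /p mxE mulr_gt0 // invr_gt0.
have p_sum1 : \sum_i p i = 1.
  by under eq_bigr do rewrite /p mxE; rewrite -mulr_sumr mulVf ?gt_eqF.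
have row_neq0 := surjective_row_neq0 _ _ _ _ A_surj.
have to0 q : exists u, run (queue_step A s) q u = 0.
  exact: reach0 A s s_rule s_idle row_neq0 q.
have reachableP x y :
    reachable P Q x y <-> exists u, run (queue_step A s) x u = y.
  split=> [[t]|[u <-]]; first exact: run_of_prob_gt0 (Q_chain x) (Q_start x) _ _.
  by exists (size u); exact: prob_run_gt0 (Q_chain x) (Q_start x) _ p_gt0.
have [mu [mu0 Amu]] := A_mu.
pose nu : 'cV[R]_m := (\sum_i lam i 0)^-1 *: mu.
have nu_gt0 k : 0 < nu k 0 by rewrite mxE mulr_gt0 // invr_gt0.
have A_nu : natmx R A *m nu = normalize lam by rewrite -scalemxAr Amu.
have [b [F b0 drift]] := sqnorm_drift A s (normalize lam) nu s_rule
  (fun k => col_neq0_gt0 _ _ _ k (A_col_neq0 k)) A_surj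
  (fun i => ltW (p_gt0 i)) p_sum1 nu_gt0 A_nu.
have recurrent x : reachable P Q 0 x -> positive_recurrent P Q x.
  move=> /reachableP[v rv].
  have back q : q \in F -> exists2 u, (0 < size u)%N & run (queue_step A s) q u = x.
    (* The path goes through 0. The initial letter [i0] makes the word nonempty, as a return needs
       at least one step. *)
    move=> _; have [u ru] := to0 (queue_step A s q i0).
    by exists (i0 :: u ++ v) => //; rewrite /run /= foldl_cat -/(run _ _ u) ru.
  have [C HC] := foster_taboo p (queue_step A s) x p_gt0 p_sum1
    sqnorm b F (fun q => sumr_ge0 _ (fun i _ => sqr_ge0 _)) b0 drift back x.
  exact: mean_return_lty (Q_chain x) (Q_start x) C HC.
split; last 1 first.
- by apply: recurrent; apply/reachableP; exists [::].
- apply/seteqP; split=> [x []//|x rx]; split=> //.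
  (* The way back exists because 0 is reachable from every state. *)
  exact/reachableP.
- by move=> x [rx _]; exact: recurrent.
Qed.
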